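(* Let $p$ be a prime. Every $p$-group of rank at most $4$, i.e. every group of order $p^n$ with $n\le 4$, is totally unramified.
   Context: A $p$-group of rank $n$ means a group of order $p^n$. All representations are complex. A representation is multiplicity free if it is a direct sum of pairwise non-equivalent irreducible representations; a restriction $\rho|_N$ is called trivial if every element of $N$ acts as the identity. A finite group $G$ is unramified over a nontrivial abelian normal subgroup $N$ if for every irreducible representation $\rho$ of $G$ the restriction $\rho|_N$ is multiplicity free or trivial. A finite group $G$ is totally unramified (recursively) if it is abelian or there exists a nontrivial abelian normal subgroup $N$ such that $G$ is unramified over $N$ and $G/N$ is totally unramified. *)

(* Defs.v *)
From HB Require Import structures.
From mathcomp Require Import all_boot all_order all_algebra all_fingroup.
From mathcomp Require Import all_solvable all_field all_character.
From mathcomp Require Import reals.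
From mathcomp Require Import complex.

Set Implicit Arguments.
Unset Strict Implicit.
Unset Printing Implicit Defensive.

Import GroupScope.

(* The definitions take the coefficient field F as a parameter; complex
   representations are obtained with F := R[i] for R : realType. *)

(* rG is equivalent to the external direct sum of the rS i; k may be 0. *)
Definition multiplicity_free (F : fieldType) (gT : finGroupType)
    (G : {group gT}) (n : nat) (rG : mx_representation F G n) : Prop :=
  exists (k : nat) (rS : 'I_k -> representation F G),
    [/\ forall i, mx_irreducible (rS i),
        forall i j, i != j -> ~ mx_rsim (rS i) (rS j)
      & mx_rsim rG (\big[@dadd_grepr F gT G/grepr0]_(i < k) rS i)].

Definition trivial_repr (F : fieldType) (gT : finGroupType)
    (G : {group gT}) (n : nat) (rG : mx_representation F G n) : Prop :=
  forall x, x \in G -> rG x = 1%:M%R.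

(* That N is nontrivial and abelian is required where this is used. *)
Definition unramified_over (F : fieldType) (gT : finGroupType)
    (G N : {group gT}) (nNG : N <| G) : Prop :=
  forall (n : nat) (rG : mx_representation F G n),
    mx_irreducible rG ->
    multiplicity_free (subg_repr rG (normal_sub nNG)) \/
    trivial_repr (subg_repr rG (normal_sub nNG)).

Inductive totally_unramified (F : fieldType) :
    forall gT : finGroupType, {group gT} -> Prop :=
| TotallyUnramifiedAbelian (gT : finGroupType) (G : {group gT}) :
    abelian G -> totally_unramified F G
| TotallyUnramifiedQuotient (gT : finGroupType) (G N : {group gT})
    (nNG : N <| G) :
    N :!=: 1 -> abelian N -> unramified_over F nNG ->
    totally_unramified F (G / N)%G ->
    totally_unramified F G.

(* Main.v *)
(** A nontrivial p-group G of order at most p^4 has an abelian maximal subgroup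
    N.  In order p^4, a normal subgroup A of order p^2 is central in some maximal
    subgroup M (any M containing A if A is central in G, else the centraliser of
    a noncentral element of A), so M / 'Z(M) is cyclic and M is abelian.  By Clifford
    theory, if rG is irreducible, the stabiliser in G of a homogeneous component
    W of its restriction to N is N or G.  In the first case W is simple over N;
    in the second N acts by scalars, so all of G does since G / N is cyclic, and
    rG is linear.  Hence homogeneous components are simple and G is unramified
    over N; conclude by induction on the order of G. *)
Require Import Defs.
From mathcomp Require Import all_boot all_order all_algebra all_fingroup.
From mathcomp Require Import all_solvable all_field all_character.
From mathcomp Require Import reals complex.

Set Implicit Arguments.
Unset Strict Implicit.
Unset Printing Implicit Defensive.

Import GroupScope GRing.Theory.

Lemma normal_p2_center_maximal (p : nat) (gT : finGroupType) (G A : {group gT}) :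
  p.-group G -> A <| G -> A \proper G -> #|A| = (p ^ 2)%N ->
  exists2 M : {group gT}, maximal M G & A \subset 'Z(M).
Proof.
move=> pG nsAG prAG oA; have [sAG nAG] := andP nsAG.
have ntG : G :!=: 1 by apply: contraTneq prAG => ->; rewrite properE sub1G andbF.
have [p_pr _ _] := pgroup_pdiv pG ntG; have pA := pgroupS sAG pG.
have abA := card_p2group_abelian p_pr oA.
have [cAG | /subsetPn[x Ax notCx]] := boolP (A \subset 'C(G)).
  have [AG | [M maxM sAM]] := maximal_exists sAG.
    by rewrite AG properxx in prAG.
  exists M; rewrite // subsetI sAM (subset_trans cAG) // centS //.
  exact: proper_sub (maxgroupp maxM).
have Gx := subsetP sAG x Ax.
(* The class of [x] has [p]-power size, lies in [A] and misses 1, so it has fewer than [p ^ 2]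
   elements; it is not a singleton because [x] is noncentral. *)
have iCx : #|G : 'C_G[x]| = p.
  have [k oCl] := p_natP (pnat_dvd (dvdn_indexg G 'C_G[x]) pG).
  have lt2 : p ^ k < p ^ 2.
    rewrite -oCl index_cent1 -oA; apply: proper_card; apply/properP.
    split; first by rewrite class_sub_norm.
    exists 1; rewrite ?group1 //; apply: contra notCx => /imsetP[y Gy x1].
    by rewrite -(conjgK y x) -x1 conj1g group1.
  rewrite ltn_exp2l ?prime_gt1 // in lt2.
  case: k lt2 oCl => [|[|//]] _ // /eqP.
  rewrite expn0 indexg_eq1 subsetI subxx /= sub_cent1 => cGx.
  by rewrite cGx in notCx.
exists 'C_G[x]%G; first by apply: p_index_maximal; rewrite ?subsetIl ?iCx.
have sAC : A \subset 'C_G[x] by rewrite subsetI sAG sub_cent1 (subsetP abA).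
(* [A :&: 'Z(G)] is nontrivial since [G] is nilpotent, and gaining [x] makes the intersection with
   the centre of ['C_G[x]] strictly larger: its order is at least [p ^ 2], so it is all of [A]. *)
have sZB : A :&: 'Z(G) \proper A :&: 'Z('C_G[x]).
  apply/properP; split.
    rewrite subsetI subsetIl subsetI (subset_trans (subsetIl _ _) sAC) /=.
    by rewrite subIset // orbC (subset_trans (subsetIr _ _)) ?centS ?subsetIl.
  exists x; last by rewrite !inE (negPf notCx) !andbF.
  by rewrite inE Ax inE inE Gx cent1id -sub_cent1 subsetIr.
have ntAZ : A :&: 'Z(G) != 1.
  apply: meet_center_nil (pgroup_nil pG) nsAG _.
  by rewrite -cardG_gt1 oA (@ltn_exp2l p 0) ?prime_gt1.
have [_ _ [k oAZ]] := pgroup_pdiv (pgroupS (subsetIl A 'Z(G)) pA) ntAZ.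
have [j oB] := p_natP (pgroupS (subsetIl A 'Z('C_G[x])) pA).
have := proper_card sZB; rewrite oAZ oB ltn_exp2l ?prime_gt1 // => lt_kj.
suff /eqP <- : A :&: 'Z('C_G[x]) == A by rewrite subsetIr.
rewrite eqEcard subsetIl oA oB leq_exp2l ?(prime_gt1 p_pr) //.
exact: leq_trans lt_kj.
Qed.

Lemma pgroup_abelian_maximal (p : nat) (gT : finGroupType) (G : {group gT}) :
  p.-group G -> G :!=: 1 -> logn p #|G| <= 4 ->
  exists2 M : {group gT}, maximal M G & abelian M.
Proof.
move=> pG ntG le4; have [p_pr _ _] := pgroup_pdiv pG ntG.
have log_max (M : {group gT}) : maximal M G -> (logn p #|M|).+1 = logn p #|G|.
  move=> maxM; have sMG := proper_sub (maxgroupp maxM).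
  rewrite -(Lagrange sMG) lognM ?cardG_gt0 ?indexg_gt0 //.
  by rewrite (p_maximal_index pG maxM) (pfactorK 1) // addn1.
(* Below order [p ^ 4], any maximal subgroup has order at most [p ^ 2] and is therefore abelian. *)
have [le3 | gt3] := leqP (logn p #|G|) 3.
  have [G1 | [M maxM _]] := maximal_exists (sub1G G).
    by rewrite -G1 eqxx in ntG.
  have sMG := proper_sub (maxgroupp maxM).
  exists M => //; apply: (p2group_abelian (pgroupS sMG pG)).
  by rewrite -ltnS log_max.
have [A [sAG nsAG oA]] :=
  normal_pgroup pG (normal_refl G) (ltnW (ltnW gt3) : 2 <= _).
have prAG : A \proper G.
  rewrite properEcard sAG (card_pgroup pG) oA ltn_exp2l ?prime_gt1 //.
  exact: ltnW gt3.
have [M maxM sAZ] := normal_p2_center_maximal pG nsAG prAG oA.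
exists M => //; have pM := pgroupS (proper_sub (maxgroupp maxM)) pG.
(* [M / 'Z(M)] has order dividing [p]: [#|M|] divides [p ^ 3], while [#|A| = p ^ 2] divides the
   order of the centre. *)
apply: cyclic_center_factor_abelian; apply: (dvdn_prime_cyclic p_pr).
rewrite card_quotient ?normal_norm ?center_normal //.
rewrite -(@dvdn_pmul2l (p ^ 2)) ?expn_gt0 ?prime_gt0 // -oA.
apply: dvdn_trans (_ : #|M| %| _).
  by rewrite -(Lagrange (center_sub M)) dvdn_mul ?cardSg.
rewrite (card_pgroup pM) oA -expnSr dvdn_exp2l //.
by rewrite -ltnS log_max.
Qed.

Local Open Scope ring_scope.

Section AbelianMaximal.

Variables (F : closedFieldType) (gT : finGroupType) (G N : {group gT}).
Variables (n : nat) (rG : mx_representation F G n).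
Hypotheses (nsNG : N <| G) (abN : abelian N) (irrG : mx_irreducible rG).

Let rN := subg_repr rG (normal_sub nsNG).

(** Over a closed field the simple module [M] is a line, so [x] acts on it by a scalar; the
    component is a sum of isomorphic copies of [M], all with this same scalar. *)
Lemma abelian_component_scalar (M : 'M[F]_n) (x : gT) :
  mxsimple rN M -> x \in N ->
  exists a : F, component_mx rN M *m rN x = a *: component_mx rN M.
Proof.
move=> simM Nx; have [modM nzM _] := simM.
have splitN := @group_closure_closed_field F gT N.
have rM1 := mxsimple_abelian_linear splitN abN simM.
have nzv : nz_row M != 0 by rewrite nz_row_eq0.
have sMv : (M <= nz_row M)%MS.
  by rewrite -(geq_leqif (mxrank_leqif_sup (nz_row_sub M))) rM1 lt0n mxrank_eq0.
have [a va] : exists a, nz_row M *m rN x = a *: nz_row M.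
  apply/sub_rVP; apply: submx_trans sMv.
  exact: submx_trans (submxMr _ (nz_row_sub M)) (mxmoduleP modM x Nx).
have Ma : M *m rN x = a *: M.
  by have /submxP[D ->] := sMv; rewrite -mulmxA va scalemxAr.
have [I [U isoU ->]] := component_mx_def simM.
(* Read as inclusion in the kernel of [rN x - a%:M], the equation can be checked on each summand
   [U i]. *)
exists a; apply/eqP; rewrite -subr_eq0 -mul_mx_scalar -mulmxBr; apply/eqP.
apply/sub_kermxP/sumsmx_subP=> i _; apply/sub_kermxP.
have [f _ /hom_mxP homf defU] := isoU i.
have /submxP[B ->] : (U i <= M *m f)%MS by rewrite defU.
by rewrite -mulmxA mulmxBr -homf // Ma mul_mx_scalar scalemxAl subrr mulmx0.
Qed.

(** Scalars preserve every line, so by irreducibility a single nonzero row spans the space. *)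
Lemma scalar_irr_linear : G \subset rcenter rG -> n = 1%N.
Proof.
move=> sGZ; have [n_gt0 irr] := (mx_irrP rG).1 irrG.
pose v := nz_row (1%:M : 'M[F]_n).
have nzv : v != 0.
  by rewrite nz_row_eq0 -mxrank_eq0 mxrank1 -lt0n.
have /eqP : row_full <<v>>%MS.
  apply: irr; last by rewrite -mxrank_eq0 genmxE mxrank_eq0.
  apply/mxmoduleP=> x /(subsetP sGZ)/setIdP[_ /is_scalar_mxP[a ->]].
  by rewrite mul_mx_scalar scalemx_sub.
by rewrite genmxE rank_rV nzv.
Qed.

Hypothesis maxN : maximal N G.

Lemma sub_rcenter_maximal_linear : N \subset rcenter rG -> n = 1%N.
Proof.
move=> sNZ; have absG := @group_closure_closed_field F gT G n rG irrG.
apply: scalar_irr_linear; have [_ nmaxN] := maxgroupP maxN.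
apply/subsetP=> x Gx; have [/(subsetP sNZ) //| notNx] := boolP (x \in N).
(* The elements whose action commutes with [rG x] form a subgroup containing both [N] and [x], hence
   all of [G]; Schur's lemma then makes [rG x] scalar. *)
pose C := rcent_group rG (rG x).
have sNC : N \subset C.
  apply/subsetP=> y /(subsetP sNZ)/setIdP[Gy /is_scalar_mxP[a rGy]].
  by rewrite inE Gy rGy scalar_mxC /=.
have Cx : x \in C by rewrite inE Gx /=.
have CG : C :=: G.
  apply/eqP; rewrite eqEproper rcent_sub /=; apply: contra notNx => prCG.
  by rewrite -(nmaxN C prCG sNC).
rewrite inE Gx /=; apply: (mx_abs_irr_cent_scalar absG).
by apply/centgmxP=> y Gy; have: y \in C; [rewrite CG | case/setIdP=> _ /eqP].
Qed.

Variable sN : socleType rN.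

Lemma abelian_maximal_component_simple (W : sN) : mxsimple rN W.
Proof.
have [prNG nmaxN] := maxgroupP maxN; have simW := socle_simple W.
have modW : mxmodule rN W := component_mx_module _ _.
have sNS : N \subset rstabs rG W.
  apply/subsetP=> x Nx; rewrite inE (subsetP (normal_sub nsNG)) //=.
  exact: (mxmoduleP modW).
have [prS | ] := boolP (rstabs rG W \proper G).
  have SN : rstabs rG W = N.
    exact: nmaxN (rstabs_group rG W) prS sNS.
  have [_ nzW minW] := Clifford_rstabs_simple irrG W.
  split=> // U modU; apply: minW; apply/mxmoduleP=> x; rewrite /= SN.
  exact: (mxmoduleP modU).
rewrite properE rstabs_sub negbK => sGS.
have modGW : mxmodule rG W := sGS.
have fullW : row_full W := ((mx_irrP rG).1 irrG).2 _ modGW (nz_socle W).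
have sNZ : N \subset rcenter rG.
  apply/subsetP=> x Nx; rewrite inE (subsetP (normal_sub nsNG)) //=.
  have [a Wa] := abelian_component_scalar simW Nx.
  apply/is_scalar_mxP; exists a; apply: (row_full_inj fullW).
  by rewrite mul_mx_scalar -Wa.
apply: linear_mxsimple => //; rewrite (eqP fullW).
exact: sub_rcenter_maximal_linear.
Qed.

End AbelianMaximal.

Lemma unramified_abelian_maximal (F : closedFieldType) (gT : finGroupType)
    (G N : {group gT}) (nsNG : N <| G) :
  maximal N G -> abelian N -> unramified_over F nsNG.
Proof.
move=> maxN abN n rG irrG; left.
set rN := subg_repr _ _; pose sN : socleType rN := DecSocleType rN.
(* A simple component equals its chosen simple submodule, so each isomorphism type occurs exactly
   once. *)
have simW (W : sN) : (socle_base W :=: W)%MS.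
  have [_ _ minW] := abelian_maximal_component_simple abN irrG maxN W.
  have [modM nzM _] := socle_simple W.
  have sMW := component_mx_id (socle_simple W).
  by apply/eqmxP; rewrite sMW minW.
pose rS (i : 'I_#|sN|) := Representation (socle_repr (enum_val i : sN)).
exists #|sN|, rS; split=> [i | i j ne_ij | ].
- exact: socle_irr.
- by move/socle_rsimP; rewrite (inj_eq enum_val_inj) (negPf ne_ij).
(* By Clifford's theorem the restriction to [N] is semisimple: its socle is the whole space. *)
have defS : (\sum_(i < #|sN|) socle_base (enum_val i : sN) :=: 1%:M)%MS.
  rewrite -(Clifford_Socle1 irrG sN) /Socle.
  rewrite [X in (_ :=: X)%MS](reindex _ (onW_bij _ (enum_val_bij sN))) /=.
  exact/eqmx_sums.
have dxS : mxdirect (\sum_(i < #|sN|) socle_base (enum_val i : sN)).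
  apply/mxdirectP; rewrite /= defS -(Clifford_Socle1 irrG sN).
  rewrite (mxdirectP (Socle_direct sN)) /=.
  rewrite [LHS](reindex _ (onW_bij _ (enum_val_bij sN))) /=.
  by apply: eq_bigr => i _; rewrite simW.
apply: mx_rsim_trans (mx_rsim_sym (rsim_submod1 (mxmodule1 rN) (eqmx_refl _))) _.
apply: (mx_rsim_dsum (modU := fun i => socle_module (enum_val i : sN))) => //.
by move=> i; apply: mx_rsim_refl.
Qed.

Lemma pgroup_totally_unramified (F : closedFieldType) (p : nat)
    (gT : finGroupType) (G : {group gT}) :
  p.-group G -> (logn p #|G| <= 4)%N -> totally_unramified F G.
Proof.
(* The induction generalises over [gT] because [G / N] lives in another group type. *)
have [m] := ubnP #|G|; elim: m => // m IHm in gT G * => /ltnSE leGm pG le4.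
have [abG | nabG] := boolP (abelian G).
  exact: TotallyUnramifiedAbelian.
have ntG : G :!=: 1%g by apply: contraNneq nabG => ->; apply: abelian1.
have [N maxN abN] := pgroup_abelian_maximal pG ntG le4.
have nsNG := p_maximal_normal pG maxN.
have ntN : N :!=: 1%g.
  (* If [N] were trivial, [G] would have prime order [p] and be cyclic. *)
  apply: contraNneq nabG => N1; apply: cyclic_abelian.
  have [p_pr _ _] := pgroup_pdiv pG ntG.
  by apply: prime_cyclic; rewrite -indexg1 -N1 (p_maximal_index pG maxN).
have unrN : unramified_over F nsNG by apply: unramified_abelian_maximal.
apply: (TotallyUnramifiedQuotient ntN abN unrN).
apply: IHm; rewrite ?quotient_pgroup //.
  exact: leq_trans (ltn_quotient ntN (normal_sub nsNG)) leGm.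
apply: leq_trans le4; apply: dvdn_leq_log; rewrite ?cardG_gt0 //.
exact: dvdn_quotient.
Qed.

Theorem proposition6p7 (R : realType) (p n : nat) (gT : finGroupType)
    (G : {group gT}) :
  prime p -> (n <= 4)%N -> #|G| = (p ^ n)%N ->
  totally_unramified (complex R) G.
Proof.
move=> p_pr le4 oG; apply: (@pgroup_totally_unramified _ p).
  by rewrite /pgroup oG pnatX pnat_id.
by rewrite oG pfactorK.
Qed.
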